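(* Let $\varphi(x)=e^{-|x|}$. Assume that $v_0 \in H^1(\mathbb{R}) \cap C^1_0 \cap L^1(\mathbb{R})$ with $v_0(0)=0$ and $\alpha := \lim_{x \to 0^+} v_0'(x) \neq 0$. Let $v\in C(\mathbb{R},H^1(\mathbb{R})\cap C^1_0)$ be the unique global solution, satisfying $v(t,0)=0$ for every $t$, of the Cauchy problem $$v_t = \left[ 1 - \varphi(x) \right] v_x + \varphi(x) \int_0^x v(t,y)\, dy, \qquad v|_{t=0}=v_0.$$ Then, for every $t \geq 0$, $$\| v(t,\cdot) \|_{L^{\infty}(0,\infty)} \leq \| v_0 \|_{L^{\infty}(0,\infty)} + \| v_0 \|_{L^1(0,\infty)}, \quad \| v(t,\cdot) \|_{L^{\infty}(-\infty,0)} \leq 2 \| v_0 \|_{L^{\infty}(-\infty,0)}$$ and $$\| v_x(t,\cdot) \|_{L^{\infty}(0,\infty)} \geq \alpha e^t, \quad \| v_x(t,\cdot) \|_{L^{\infty}(-\infty,0)} \leq \| v_0' \|_{L^{\infty}(-\infty,0)} + 2 \| v_0 \|_{L^{\infty}(-\infty,0)}.$$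
   Context: The space $C^1_0$ is $$C^1_0 := \{ v \in C^0(\mathbb{R}) \cap C^1(\mathbb{R}^-) \cap C^1(\mathbb{R}^+): \ v, \partial_x v \in L^{\infty}(\mathbb{R}) \},$$ i.e. bounded continuous functions on $\mathbb{R}$ that are piecewise continuously differentiable, with a finite jump discontinuity of the first derivative at $x=0$ and bounded first derivative away from $x=0$. For $v_0\in H^1\cap C^1_0$ with $v_0(0)=0$, the Cauchy problem has a unique global solution $v\in C(\mathbb{R},H^1\cap C^1_0)$ with $v(t,0)=0$ for every $t\in\mathbb{R}$. *)

(* Defs.v *)
From HB Require Import structures.
From mathcomp Require Import all_boot all_order all_algebra.
From mathcomp Require Import all_classical all_reals all_analysis.
Import Order.TTheory GRing.Theory Num.Theory.
Import numFieldNormedType.Exports.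

Set Implicit Arguments.
Unset Strict Implicit.
Unset Printing Implicit Defensive.

Local Open Scope ring_scope.
Local Open Scope classical_set_scope.

Definition peakon (R : realType) (x : R) : R := expR (- `|x|).

Definition Rpos (R : realType) : set R := `]0, +oo[.

Definition Rneg (R : realType) : set R := `]-oo, 0[.

(* L^p norm over a measurable D, as the norm over R of the extension by 0. *)
Definition Lnorm_on (R : realType) (p : \bar R) (D : set R) (u : R -> R) :
    \bar R :=
  'N[lebesgue_measure]_p[EFin \o (u \_ D)]%E.

Definition test_function (R : realType) (psi : R -> R) : Prop :=
  (forall (n : nat) (x : R), derivable (psi^`(n)) x 1) /\
  (exists M : R, forall x : R, M < `|x| -> psi x = 0).

Definition is_weak_derivative (R : realType) (u g : R -> R) : Prop :=
  forall psi : R -> R, test_function psi ->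
    \int[lebesgue_measure]_(x in [set: R]) (u x * psi^`()%classic x) =
    - \int[lebesgue_measure]_(x in [set: R]) (g x * psi x).

Definition L2_weak_derivatives (R : realType) (u : R -> R) : set (R -> R) :=
  [set g | g \in Lfun lebesgue_measure 2%:E /\ is_weak_derivative u g].

Definition H1 (R : realType) : set (R -> R) :=
  [set u | u \in Lfun lebesgue_measure 2%:E /\ L2_weak_derivatives u !=set0].

(* The representative chosen by [xget] is immaterial in [H1_norm]: two weak
   derivatives of the same function agree almost everywhere. *)
Definition weak_derivative (R : realType) (u : R -> R) : R -> R :=
  xget (cst 0) (L2_weak_derivatives u).

Definition H1_norm (R : realType) (u : R -> R) : \bar R :=
  ((Lnorm_on 2%:E setT u `^ 2 + Lnorm_on 2%:E setT (weak_derivative u) `^ 2)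
     `^ 2^-1)%E.

(* [u^`()] takes an arbitrary value at 0 when the two one-sided limits of the
   derivative differ; no clause below depends on that value. *)
Definition C10 (R : realType) : set (R -> R) :=
  [set u |
    [/\ continuous u,
        forall x : R, x != 0 -> derivable u x 1 /\ {for x, continuous u^`()},
        cvg (u^`() x @[x --> 0^'-]) /\ cvg (u^`() x @[x --> 0^'+]),
        u \in Lfun lebesgue_measure +oo%E &
        u^`() \in Lfun lebesgue_measure +oo%E]].

Definition C10_norm (R : realType) (u : R -> R) : \bar R :=
  (Lnorm_on +oo setT u + Lnorm_on +oo setT u^`())%E.

(* v \in C(R, H^1 \cap C^1_0), where the intersection carries the sum norm. *)
Definition continuous_in_H1_C10 (R : realType) (v : R -> R -> R) : Prop :=
  (forall t : R, H1 (v t) /\ C10 (v t)) /\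
  (forall t0 : R,
    (H1_norm (v t \- v t0)%R + C10_norm (v t \- v t0)%R)%E
      @[t --> t0] --> 0%E).

(* \int_0^x u(y) dy, with the usual sign when x < 0. *)
Definition int0 (R : realType) (u : R -> R) (x : R) : R :=
  if 0 <= x then \int[lebesgue_measure]_(y in `[0, x]) u y
  else - \int[lebesgue_measure]_(y in `[x, 0]) u y.

(* The equation is imposed pointwise off x = 0, where v_x exists classically;
   at x = 0 it would read v_t(t, 0) = 0. *)
Definition solves_Cauchy (R : realType) (v0 : R -> R) (v : R -> R -> R) :
    Prop :=
  [/\ continuous_in_H1_C10 v,
      v 0 = v0 &
      forall t x : R, x != 0 ->
        is_derive t (1 : R) (fun s => v s x)
          ((1 - peakon x) * (v t)^`()%classic x + peakon x * int0 (v t) x)].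

(* Main.v *)
Require Import Defs.
From HB Require Import structures.
From mathcomp Require Import all_boot all_order all_algebra.
From mathcomp Require Import all_classical all_reals all_analysis.
From mathcomp Require Import measurable_realfun ess_sup_inf ring lra.
Import Order.TTheory GRing.Theory Num.Theory.
Import numFieldNormedType.Exports.

Local Open Scope ring_scope.
Local Open Scope classical_set_scope.

(** The equation is solved explicitly by characteristics, and the four
    estimates are read off the formula.

    On x > 0 put V(t,x) = \int_0^x v(t,y) dy.  An integration by parts turns
    the equation for v into V_t = (1 - e^-x) v - e^-x V
    ([derive_antiderivative_time]), so the pair (v, V) satisfies a closed
    system along the curves X' = -(1 - e^-X).  With E = e^X - 1, which satisfies
    E' = -E, both V (1 + 1/E) and v - V/E are constant along such a curve.
    The curve through (t,x) starts at X = ln (1 + (e^x - 1) e^t), and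
    eliminating V(t,x) between the two invariants gives, for every real t,
<<
      v(t,x) = v(0,X) + (1 - e^-t) e^-x V(0,X)       ([halfline_formula]).
>>
    The equation is invariant under (t,x) -> (-t,-x), so the forward evolution
    on x < 0 is the backward evolution on x > 0, to which the same formula
    applies ([cauchy_halfline_neg]).

    For t >= 0 the weight (1 - e^-t) e^-x lies in [0,1], which is the first
    bound.  For t <= 0 the curves have moved away from 0 and
    |V(0,X)| <= X sup |v(0,.)|, so that the bounds on the weight times X and on
    the weight times dX/dx in [backward_weight] give the second and the fourth.
    For the third, differentiating the formula in x and letting x -> 0+ gives
    v_x(t,0+) = v_x(0,0+) (dX/dx)(0) = alpha e^t ([halfline_slope_at0]).

    The equation gives a time derivative at each point separately.  What allows
    differentiation along curves ([is_derive_along_curve]) and under the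
    integral sign is the continuity of t |-> v(t) in the C^1_0 norm, which makes
    v and v_x vary uniformly in x ([cauchy_unif]). *)

(** * One-variable calculus *)

(** Differentiability as an increment estimate: the form in which error terms
    can be added up. *)
Lemma is_derive1_leP (R : realType) (f : R -> R) (x l : R) :
  is_derive x 1 f l <->
  (forall e, 0 < e -> \forall y \near x, `|f y - f x - l * (y - x)| <= e * `|y - x|).
Proof.
split=> [[dx <-] e e0|H].
  have /cvgrPdist_le/(_ e e0) : h^-1 *: ((f \o shift x) (h *: 1) - f x) @[h --> 0^'] --> 'D_1 f x := dx.
  rewrite near_withinE => h1.
  have {}h1 := eq_ind _ id h1 _ (near_shift x 0 _); near=> y.
  have [->|yx] := eqVneq y x; first by rewrite !subrr mulr0 subrr !normr0 mulr0.
  have yx0 : y - x != 0 by rewrite subr_eq0.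
  have : y - x != 0 -> `|'D_1 f x - (y - x)^-1 *: (f ((y - x) *: 1 + x) - f x)| <= e.
    by near: y; apply: filterS h1 => y /=; rewrite sub0r.
  move=> /(_ yx0); rewrite [_ *: 1]mulr1 subrK => h2.
  rewrite -ler_pdivrMr ?normr_gt0// -normfV -normrM.
  apply: le_trans h2; rewrite le_eqVlt -normrN; apply/orP; left; apply/eqP; congr (`| _ |).
  by rewrite /GRing.scale/=; field.
have lim : h^-1 *: ((f \o shift x) (h *: 1) - f x) @[h --> 0^'] --> l.
  apply/cvgrPdist_le => e e0.
  rewrite near_withinE; apply: (eq_ind_r id _ (near_shift x 0 _)).
  apply: filterS (H e e0) => y /=; rewrite sub0r => + yx0.
  rewrite -ler_pdivrMr ?normr_gt0// -normfV -normrM.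
  apply: le_trans; rewrite le_eqVlt -normrN; apply/orP; left; apply/eqP; congr (`| _ |).
  by rewrite [_ *: 1]mulr1 subrK /GRing.scale/=; field.
by split; [apply/cvg_ex; exists l | exact/cvg_lim].
Unshelve. all: by end_near. Qed.

(** The mean value theorem with [a] and [b] in either order, which a time
    increment of unknown sign requires. *)
Lemma MVT_ball (R : realType) (f df : R -> R) (a b : R) :
  (forall z, `|z - a| <= `|b - a| -> is_derive z 1 f (df z)) ->
  exists2 c, `|c - a| <= `|b - a| & f b - f a = df c * (b - a).
Proof.
move=> H.
have cont (p q : R) : (forall z, p <= z <= q -> `|z - a| <= `|b - a|) ->
    {within `[p, q], continuous f}.
  move=> pq; apply: derivable_within_continuous => z; rewrite in_itv/= => zpq.
  by have [] := H _ (pq _ zpq).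
have [ab|/ltW ba] := leP a b.
  have A z : a <= z <= b -> `|z - a| <= `|b - a|.
    by move=> zab; rewrite !ger0_norm; lra.
  have [|c cab E] := @MVT_segment R f df a b ab _ (cont _ _ A).
    by move=> z; rewrite in_itv/= => zab; apply/H/A; lra.
  by exists c => //; apply: A; move: cab; rewrite in_itv/=.
have A z : b <= z <= a -> `|z - a| <= `|b - a|.
  by move=> zab; rewrite !ler0_norm; lra.
have [|c cab E] := @MVT_segment R f df b a ba _ (cont _ _ A).
  by move=> z; rewrite in_itv/= => zab; apply/H/A; lra.
exists c; first by apply: A; move: cab; rewrite in_itv/=.
by rewrite -opprB E; ring.
Qed.

(** The rules of differentiation for functions given by their values at [y], so
    that derivations of closed formulas can be assembled as terms. *)
Section pointwise_rules.
Context {R : realType}.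
Implicit Types (f g : R -> R) (x a b : R).

Lemma is_derive1D {f g x a b} : is_derive x 1 f a -> is_derive x 1 g b ->
  is_derive x 1 (fun y => f y + g y) (a + b).
Proof. exact: is_deriveD. Qed.

Lemma is_derive1N {f x a} : is_derive x 1 f a -> is_derive x 1 (fun y => - f y) (- a).
Proof. exact: is_deriveN. Qed.

Lemma is_derive1B {f g x a b} : is_derive x 1 f a -> is_derive x 1 g b ->
  is_derive x 1 (fun y => f y - g y) (a - b).
Proof. exact: is_deriveB. Qed.

Lemma is_derive1M {f g x a b} : is_derive x 1 f a -> is_derive x 1 g b ->
  is_derive x 1 (fun y => f y * g y) (f x * b + g x * a).
Proof. exact: is_deriveM. Qed.

Lemma is_derive1V {f x a} : f x != 0 -> is_derive x 1 f a ->
  is_derive x 1 (fun y => (f y)^-1) (- (f x) ^- 2 * a).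
Proof.
move=> fx0 [df <-]; split; first exact: derivableV.
by rewrite deriveV.
Qed.

Lemma is_derive1C {f g x a b} : is_derive (g x) 1 f a -> is_derive x 1 g b ->
  is_derive x 1 (fun y => f (g y)) (a * b).
Proof. exact: is_derive1_comp. Qed.

End pointwise_rules.

Lemma is_derive1_continuous {R : realType} {f : R -> R} {x l : R} :
  is_derive x 1 f l -> {for x, continuous f}.
Proof. by move=> [df _]; apply/differentiable_continuous/derivable1_diffP. Qed.

Lemma is_derive1_expRN {R : realType} (x : R) :
  is_derive x 1 (fun y : R => expR (- y)) (- expR (- x)).
Proof. by rewrite -mulrN1; apply: is_derive1C. Qed.

Lemma antiderivative_le {R : realType} (F f : R -> R) (M : R) :
  (forall x : R, is_derive x 1 F (f x)) -> F 0 = 0 ->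
  (forall x : R, 0 < x -> `|f x| <= M) -> forall x : R, 0 < x -> `|F x| <= M * x.
Proof.
move=> dF F0 fM x x0.
have [|c cx E] := @MVT R F f 0 x x0 (fun y _ => dF y).
  by apply: derivable_within_continuous => y _; have [] := dF y.
have c0 : 0 < c by move: cx; rewrite in_itv/=; lra.
rewrite F0 !subr0 in E.
by rewrite E normrM (ger0_norm (ltW x0)) ler_wpM2r ?fM// ltW.
Qed.

(** The increment of [u] along the curve is split at the fixed abscissa [X t0],
    so that a time derivative at that single point suffices; the remaining part
    is an increment in [x], which the mean value theorem and the joint
    continuity of [ux] control. *)
Lemma is_derive_along_curve (R : realType) (u ux : R -> R -> R) (X : R -> R) (t0 a b : R) :
  is_derive t0 1 (u^~ (X t0)) a -> is_derive t0 1 X b ->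
  (\forall p \near ((t0, X t0) : R * R), is_derive p.2 (1 : R) (u p.1) (ux p.1 p.2)) ->
  {for (t0, X t0), continuous (fun p : R * R => ux p.1 p.2)} ->
  is_derive t0 1 (fun t => u t (X t)) (a + ux t0 (X t0) * b).
Proof.
move=> du dX near_ux cont_ux; apply/is_derive1_leP => e e0.
(* [k] collects the factors of [d] in the final sum of the three errors *)
pose k := `|b| + 1 + 1 + `|ux t0 (X t0)|.
have k0 : 0 < k by rewrite /k; have := normr_ge0 b; have := normr_ge0 (ux t0 (X t0)); lra.
pose d := e / k.
have d0 : 0 < d by rewrite divr_gt0.
have /cvgrPdist_le/(_ d d0) cux := cont_ux.
have [[A B]/= [nA nB] AB] : nbhs ((t0, X t0) : R * R) [set p : R * R | is_derive p.2 (1 : R) (u p.1) (ux p.1 p.2) /\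
    `|ux t0 (X t0) - ux p.1 p.2| <= d].
  by apply: filterS2 near_ux cux => -[t x]/=.
have [/= r r0 Br] := (iffLR (nbhs_ballP _ _)) nB.
have cX : {for t0, continuous X}.
  by apply/differentiable_continuous/derivable1_diffP; case: dX.
have /is_derive1_leP/(_ d d0) hu := du.
have /is_derive1_leP/(_ d d0) hX := dX.
have /is_derive1_leP/(_ 1 ltr01) hX1 := dX.
near=> t.
have tA : A t by near: t.
have Xr : `|X t - X t0| < r.
  rewrite distrC; near: t; exact: (iffLR (cvgrPdist_lt _ _) cX).
have inB z : `|z - X t0| <= `|X t - X t0| -> B z.
  by move=> zX; apply: Br; rewrite /ball/= distrC; apply: le_lt_trans Xr.
have [|c cX0 E] := @MVT_ball R (u t) (ux t) (X t0) (X t).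
  by move=> z /inB zB; have [] := AB (t, z) (conj tA zB).
have [_ /= uxc] := AB (t, c) (conj tA (inB _ cX0)).
have H1 : `|u t (X t0) - u t0 (X t0) - a * (t - t0)| <= d * `|t - t0| by near: t.
have H2 : `|X t - X t0 - b * (t - t0)| <= d * `|t - t0| by near: t.
have H3 : `|X t - X t0 - b * (t - t0)| <= 1 * `|t - t0| by near: t.
have H4 : `|X t - X t0| <= (`|b| + 1) * `|t - t0|.
  rewrite (_ : X t - X t0 = (X t - X t0 - b * (t - t0)) + b * (t - t0)); last by ring.
  by rewrite (le_trans (ler_normD _ _))// normrM; lra.
rewrite (_ : _ - _ = (u t (X t0) - u t0 (X t0) - a * (t - t0))
   + (- (ux t0 (X t0) - ux t c) * (X t - X t0) + ux t0 (X t0) * (X t - X t0 - b * (t - t0)))); last first.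
  by rewrite -[u t (X t)](subrK (u t (X t0))) E; ring.
have -> : e = d * k by rewrite /d divfK// gt_eqF.
rewrite (le_trans (ler_normD _ _))//.
rewrite (le_trans (lerD H1 (ler_normD _ _)))// !normrM normrN.
have H5 := ler_pM (normr_ge0 _) (normr_ge0 _) uxc H4.
have H6 := ler_wpM2l (normr_ge0 (ux t0 (X t0))) H2.
by rewrite /k; lra.
Unshelve. all: by end_near. Qed.

Lemma locally_uniform_jointly_continuous (R : realType) (w : R -> R -> R) (t0 x0 : R) : 0 < x0 ->
  {for x0, continuous (w t0)} ->
  (forall e, 0 < e -> \forall t \near t0, forall x, 0 < x -> `|w t x - w t0 x| <= e) ->
  {for (t0, x0), continuous (fun p : R * R => w p.1 p.2)}.
Proof.
move=> x00 cw uw; apply/cvgrPdist_le => e e0 /=.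
have e2 : 0 < e / 2 by lra.
exists ([set t : R | forall x, 0 < x -> `|w t x - w t0 x| <= e / 2],
        [set x : R | 0 < x /\ `|w t0 x0 - w t0 x| <= e / 2]).
  split; first exact: uw.
  have xpos : \forall x \near x0, 0 < x by exact: lt_nbhsr.
  have /cvgrPdist_le/(_ _ e2) cwe := cw.
  near=> x; split; first by near: x.
  by near: x.
move=> [t x] [/= H1 [x1 H2]].
have H := H1 _ x1.
rewrite (_ : _ - _ = (w t0 x0 - w t0 x) - (w t x - w t0 x)); last by ring.
by rewrite (le_trans (ler_normB _ _))//; lra.
Unshelve. all: by end_near. Qed.

(** * The equation on the half-line x > 0 *)

(** What the solution and its reflection (t,x) -> (-t,-x) have in common; the
    nonlocal term is described by an antiderivative [V] vanishing at 0, whose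
    form survives reflection, and [ux] is the derivative off 0 only. *)
Record halfline_solution {R : realType} (u ux V : R -> R -> R) : Prop := {
  hs_ux : forall t x : R, 0 < x -> is_derive x (1 : R) (u t) (ux t x) ;
  hs_cont_ux : forall t x : R, 0 < x -> {for x, continuous (ux t)} ;
  hs_V : forall t x : R, is_derive x (1 : R) (V t) (u t x) ;
  hs_V0 : forall t, V t 0 = 0 ;
  hs_cont_u : forall t, continuous (u t) ;
  hs_unif : forall t0 e : R, 0 < e -> \forall t \near t0, forall x : R, 0 < x ->
    `|u t x - u t0 x| <= e /\ `|ux t x - ux t0 x| <= e ;
  hs_eq : forall t x : R, 0 < x ->
    is_derive t (1 : R) (u^~ x) ((1 - expR (- x)) * ux t x + expR (- x) * V t x)
}.
Arguments hs_ux {R u ux V}.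
Arguments hs_cont_ux {R u ux V}.
Arguments hs_V {R u ux V}.
Arguments hs_V0 {R u ux V}.
Arguments hs_cont_u {R u ux V}.
Arguments hs_unif {R u ux V}.
Arguments hs_eq {R u ux V}.

Section halfline.
Context {R : realType} {u ux V : R -> R -> R}.
Implicit Types t s x y d e : R.
Hypothesis hs : halfline_solution u ux V.

Lemma derive_flux t x : 0 < x ->
  is_derive x 1 (fun y : R => (1 - expR (- y)) * u t y - expR (- y) * V t y)
    ((1 - expR (- x)) * ux t x + expR (- x) * V t x).
Proof.
move=> x0.
have dp := is_derive1_expRN x.
have dq : is_derive x (1 : R) (fun y : R => 1 - expR (- y) : R) (0 - - expR (- x)).
  exact: (is_derive1B (is_derive_cst (1 : R) x (1 : R)) dp).
apply: (is_derive_eq (is_derive1B (is_derive1M dq (hs_ux hs t _ x0))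
  (is_derive1M dp (hs_V hs t x)))).
by ring.
Qed.

Lemma cont_flux t : continuous (fun y : R => (1 - expR (- y)) * u t y - expR (- y) * V t y).
Proof.
move=> x; apply: cvgB; apply: cvgM.
- by apply: cvgB; [exact: cvg_cst|exact: (is_derive1_continuous (is_derive1_expRN x))].
- exact: (hs_cont_u hs).
- exact: (is_derive1_continuous (is_derive1_expRN x)).
- exact: (is_derive1_continuous (hs_V hs t x)).
Qed.

(** The function (1 - e^-y) u - e^-y V vanishes at 0 and its derivative in [y]
    is the right-hand side of the equation, hence it is the time derivative of
    the integral of [u].  Differentiation under the integral sign is replaced
    by two mean value theorems, with an error that is uniform in [y] because
    [u] and [ux] vary uniformly in time. *)
Lemma derive_antiderivative_time t x : 0 < x ->
  is_derive t 1 (V^~ x) ((1 - expR (- x)) * u t x - expR (- x) * V t x).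
Proof.
move=> x0; apply/is_derive1_leP => e e0.
have k0 : 0 < (1 + x) * x by nra.
pose d := e / ((1 + x) * x).
have d0 : 0 < d by rewrite divr_gt0.
have /nbhs_ballP[/= r r0 Br] := hs_unif hs t d d0.
near=> s.
have sr : ball t r s by near: s; exact: nbhsx_ballx.
pose D y := V s y - V t y - ((1 - expR (- y)) * u t y - expR (- y) * V t y) * (s - t).
pose D' y := u s y - u t y - ((1 - expR (- y)) * ux t y + expR (- y) * V t y) * (s - t).
have dV y : is_derive y 1 (fun y : R => V s y - V t y) (u s y - u t y).
  by apply: is_derive1B; exact: (hs_V hs).
(* [D] vanishes at 0, so only its derivative in [y] has to be small *)
have [||c cx E] := @MVT R D D' 0 x x0.
- move=> y; rewrite in_itv/= => /andP[y0 _].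
  apply: (is_derive_eq (is_derive1B (dV y)
    (is_derive1M (derive_flux t _ y0) (is_derive_cst (s - t) y (1 : R))))).
  by rewrite /D' mulr0 add0r [_ * (s - t)]mulrC.
- apply: continuous_subspaceT => y; apply: cvgB.
    exact: (is_derive1_continuous (dV y)).
  by apply: cvgM; [exact: cont_flux|exact: cvg_cst].
have [c0 cx1] : 0 < c /\ c < x by move: cx; rewrite in_itv/=; lra.
have D0 : D 0 = 0.
  by rewrite /D !(hs_V0 hs) oppr0 expR0; ring.
rewrite D0 !subr0 in E; rewrite -/(D x) E.
(* the same device in time: [u] at [c] moves by its time derivative at [tau] *)
have [|tau taus E2] := @MVT_ball R (u^~ c)
   (fun t : R => ((1 - expR (- c)) * ux t c + expR (- c) * V t c)) t s.
  by move=> z _; exact: (hs_eq hs).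
have taur : ball t r tau by rewrite /ball/= distrC; apply: le_lt_trans taus _; rewrite distrC.
have uc y : 0 < y -> `|u tau y - u t y| <= d by move=> /(Br _ taur)[].
have uxc : `|ux tau c - ux t c| <= d by have [] := Br _ taur _ c0.
have Vc : `|V tau c - V t c| <= d * c.
  apply: (antiderivative_le (fun y => V tau y - V t y) (fun y => u tau y - u t y)) => //.
  - by move=> y; apply: is_derive1B; exact: (hs_V hs).
  - by rewrite !(hs_V0 hs) subrr.
rewrite /D' E2 -mulrBl !normrM (ger0_norm (ltW x0)) -mulrA (mulrC _ x) mulrA.
rewrite ler_wpM2r//.
rewrite (_ : e = d * (1 + x) * x); last by rewrite -mulrA divfK// gt_eqF.
rewrite ler_wpM2r ?(ltW x0)//.
rewrite (_ : _ - _ = (1 - expR (- c)) * (ux tau c - ux t c) + expR (- c) * (V tau c - V t c)); last by ring.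
rewrite (le_trans (ler_normD _ _))// !normrM.
have ? := expR_gt0 (- c); have ? : expR (- c) < 1 by rewrite expR_lt1; lra.
rewrite (@ger0_norm _ (1 - _)) ?(@ger0_norm _ (expR _)); [|lra..].
have : d * c <= d * x by rewrite ler_pM2l// ltW.
by have := normr_ge0 (ux tau c - ux t c); have := normr_ge0 (V tau c - V t c); nra.
Unshelve. all: by end_near. Qed.

(** * Characteristics *)

Lemma derive_antiderivative_characteristic (X : R -> R) t : 0 < X t ->
  is_derive t 1 X (- (1 - expR (- X t))) ->
  is_derive t 1 (fun s => V s (X s)) (- expR (- X t) * V t (X t)).
Proof.
move=> X0 dX; apply: is_derive_eq.
  apply: (@is_derive_along_curve _ V u X t _ _ (derive_antiderivative_time t _ X0) dX).
    by near=> p; exact: (hs_V hs).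
  apply: locally_uniform_jointly_continuous => //; first exact: (hs_cont_u hs).
  by move=> e e0; apply: filterS (hs_unif hs t e e0) => s + y y0 => /(_ y y0)[].
by ring.
Unshelve. all: by end_near. Qed.

Lemma derive_solution_characteristic (X : R -> R) t : 0 < X t ->
  is_derive t 1 X (- (1 - expR (- X t))) ->
  is_derive t 1 (fun s => u s (X s)) (expR (- X t) * V t (X t)).
Proof.
move=> X0 dX; apply: is_derive_eq.
  apply: (@is_derive_along_curve _ u ux X t _ _ (hs_eq hs t _ X0) dX).
    near=> p; apply: (hs_ux hs).
    near: p; exists (setT, [set y | 0 < y]) => /=; last by move=> [? ?] [].
    by split; [exact: filterT|exact: lt_nbhsr].
  apply: locally_uniform_jointly_continuous => //; first exact: (hs_cont_ux hs).
  by move=> e e0; apply: filterS (hs_unif hs t e e0) => s + y y0 => /(_ y y0)[].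
by ring.
Unshelve. all: by end_near. Qed.

(** The position at time 0 of the characteristic that is at [x] at time [t]:
    e^X - 1 decays exactly like e^-t along characteristics. *)
Definition foot (t x : R) : R := ln (1 + (expR x - 1) * expR t).

Definition foot_slope (t x : R) : R := expR x * expR t / (1 + (expR x - 1) * expR t).

Lemma expR_sub1_gt0 x : 0 < x -> 0 < expR x - 1.
Proof. by move=> x0; rewrite subr_gt0 expR_gt1. Qed.

Lemma foot_arg_gt0 t x : 0 <= x -> 0 < 1 + (expR x - 1) * expR t.
Proof.
move=> x0; rewrite ltr_pwDl// mulr_ge0 ?expR_ge0// subr_ge0.
by rewrite -expR0 ler_expR.
Qed.

Lemma foot_gt0 t x : 0 < x -> 0 < foot t x.
Proof.
by move=> x0; rewrite ln_gt0// ltrDl mulr_gt0 ?expR_gt0// expR_sub1_gt0.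
Qed.

Lemma derive_foot t x : 0 <= x -> is_derive x 1 (foot t) (foot_slope t x).
Proof.
move=> x0; have a0 := foot_arg_gt0 t x x0.
have dexp : is_derive x (1 : R) (fun y : R => expR y - 1 : R) (expR x - 0).
  exact: (is_derive1B (is_derive_expR x) (is_derive_cst (1 : R) x (1 : R))).
have dmul := is_derive1M dexp (is_derive_cst (expR t) x (1 : R)).
have darg := is_derive1D (is_derive_cst (1 : R) x (1 : R)) dmul.
apply: (is_derive_eq (@is_derive1C _ (@ln R)
  (fun y : R => 1 + (expR y - 1) * expR t) x _ _ (is_derive1_ln a0) darg)).
by rewrite /foot_slope /=; field; rewrite gt_eqF.
Qed.

(** The two invariants [V * (1 + E^-1)] and [u - V / E] express [u] and [V] at
    (t,x) by their values at the foot of the characteristic. *)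
Lemma halfline_formula t x : 0 < x ->
  u t x = u 0 (foot t x) + (1 - expR (- t)) * expR (- x) * V 0 (foot t x).
Proof.
move=> x0; have b0 := expR_sub1_gt0 x x0.
(* [E] is e^X - 1 along the characteristic [X] with X(t) = x *)
pose E s := (expR x - 1) * expR (t - s).
have E0 s : 0 < E s by rewrite mulr_gt0// expR_gt0.
have dE s : is_derive s 1 E (- E s).
  have dts : is_derive s (1 : R) (fun r : R => t - r : R) (-1).
    by apply: (is_derive_eq (is_derive1B (is_derive_cst t s (1 : R)) (is_derive_id s (1 : R)))); ring.
  apply: (is_derive_eq (is_derive1M (is_derive_cst (expR x - 1) s (1 : R))
    (is_derive1C (is_derive_expR _) dts))).
  by rewrite mulr0 addr0 mulrN1 mulrN.
pose X s := ln (1 + E s).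
have E10 s : 0 < 1 + E s by have := E0 s; lra.
have expNX s : expR (- X s) = (1 + E s)^-1.
  by rewrite expRN /X lnK// posrE.
have X0 s : 0 < X s by rewrite ln_gt0//; have := E0 s; lra.
have dX s : is_derive s 1 X (- (1 - expR (- X s))).
  have d1E : is_derive s (1 : R) (fun r : R => 1 + E r : R) (- E s).
    by apply: (is_derive_eq (is_derive1D (is_derive_cst (1 : R) s (1 : R)) (dE s))); ring.
  have dln := is_derive1_ln (E10 s).
  have dc := @is_derive1C _ (@ln R) (fun r : R => 1 + E r) s _ _ dln d1E.
  apply: (is_derive_eq dc).
  by rewrite expNX; field; rewrite gt_eqF.
have dVX s := derive_antiderivative_characteristic X s (X0 s) (dX s).
have duX s := derive_solution_characteristic X s (X0 s) (dX s).
have dEV s := is_derive1V (lt0r_neq0 (E0 s)) (dE s).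
have consV s : V s (X s) * (1 + (E s)^-1) = V 0 (X 0) * (1 + (E 0)^-1).
  apply: (@is_derive_0_is_cst _ (fun s => V s (X s) * (1 + (E s)^-1))) => r.
  apply: (is_derive_eq (is_derive1M (dVX r) (is_derive1D (is_derive_cst (1 : R) r (1 : R)) (dEV r)))).
  rewrite expNX /=; move: (E0 r) (E10 r); move: (E r) (V r (X r)) => a c a0 a1.
  by field; rewrite !gt_eqF.
have consu s : u s (X s) - V s (X s) * (E s)^-1 = u 0 (X 0) - V 0 (X 0) * (E 0)^-1.
  apply: (@is_derive_0_is_cst _ (fun s => u s (X s) - V s (X s) * (E s)^-1)) => r.
  apply: (is_derive_eq (is_derive1B (duX r) (is_derive1M (dVX r) (dEV r)))).
  rewrite expNX /=; move: (E0 r) (E10 r); move: (E r) (V r (X r)) => a c a0 a1.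
  by field; rewrite !gt_eqF.
have Et : E t = expR x - 1 by rewrite /E subrr expR0 mulr1.
have Xt : X t = x by rewrite /X Et addrC subrK expRK.
have XE0 : X 0 = foot t x by rewrite /X /E subr0.
have {}consV := consV t; have {}consu := consu t.
rewrite Xt XE0 Et in consV consu.
have ex0 : expR x != 0 by rewrite gt_eqF ?expR_gt0.
have et0 : expR t != 0 by rewrite gt_eqF ?expR_gt0.
have VE : V t x = V 0 (foot t x) * (1 + (E 0)^-1) / (1 + (expR x - 1)^-1).
  rewrite -consV mulfK// (_ : _ + _ = expR x / (expR x - 1)); last by field; rewrite gt_eqF.
  by rewrite mulf_neq0 ?invr_eq0// gt_eqF.
have -> : u t x = u 0 (foot t x) - V 0 (foot t x) / E 0 + V t x / (expR x - 1).
  by rewrite -consu subrK.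
rewrite VE /E subr0 !expRN; field.
by rewrite ex0 et0 gt_eqF// addrC subrK ex0.
Qed.

Lemma halfline_derivative t x : 0 < x ->
  ux t x = ux 0 (foot t x) * foot_slope t x + (1 - expR (- t)) * expR (- x) *
    (u 0 (foot t x) * foot_slope t x - V 0 (foot t x)).
Proof.
move=> x0; have X0 := foot_gt0 t x x0.
have dX := derive_foot t x (ltW x0).
have du := @is_derive1C _ (u 0) (foot t) x _ _ (hs_ux hs 0 _ X0) dX.
have dV := @is_derive1C _ (V 0) (foot t) x _ _ (hs_V hs 0 _) dX.
have dk := is_derive1M (is_derive_cst (1 - expR (- t)) x (1 : R)) (is_derive1_expRN x).
have df := is_derive1D du (is_derive1M dk dV).
have [_ <-] := hs_ux hs t _ x0.
have -> : 'D_1 (u t) x = 'D_1 (fun y : R => u 0 (foot t y) +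
    (1 - expR (- t)) * expR (- y) * V 0 (foot t y)) x.
  apply: near_eq_derive; near=> y; apply: halfline_formula.
  by near: y; exact: lt_nbhsr.
rewrite (@derive_val _ _ _ _ _ _ _ df) /=.
by ring.
Unshelve. all: by end_near. Qed.

(** * Estimates on the half-line *)

Lemma halfline_bound_forward t x : 0 <= t -> 0 < x ->
  `|u t x| <= `|u 0 (foot t x)| + `|V 0 (foot t x)|.
Proof.
move=> t0 x0; rewrite halfline_formula// (le_trans (ler_normD _ _))// lerD2l normrM.
have k0 : 0 <= 1 - expR (- t) <= 1.
  by rewrite subr_ge0 gerBl expR_ge0 andbT -expR0 ler_expR; lra.
rewrite (ger0_norm (mulr_ge0 _ _)) ?expR_ge0//; last by lra.
rewrite ler_piMl// mulr_ile1 ?expR_ge0//; first [lra | idtac].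
by rewrite ltW// expR_lt1; lra.
Qed.

(** Backward in time the weight of [V] is unbounded, like e^-t, but the foot
    and its slope are of order e^t. *)
Lemma backward_weight t x : t <= 0 -> 0 < x ->
  [/\ 0 <= foot_slope t x <= 1,
      `|(1 - expR (- t)) * expR (- x)| * foot t x <= 1 &
      `|(1 - expR (- t)) * expR (- x)| * foot_slope t x <= 1].
Proof.
move=> t0 x0; have a0 := foot_arg_gt0 t x (ltW x0).
have footle : foot t x <= (expR x - 1) * expR t.
  by apply: le_ln1Dx; rewrite (@lt_trans _ _ 0)// mulr_gt0 ?expR_gt0// expR_sub1_gt0.
have b0 := expR_gt0 t; have b1 : expR t <= 1 by rewrite -expR0 ler_expR.
have a1 : 1 < expR x by rewrite expR_gt1.
rewrite !expRN; move: a0 footle b0 b1 a1; rewrite /foot_slope.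
move: (expR x) (expR t) (foot t x) => a b X d0 Xle b0 b1 a1.
have ai : 0 < a^-1 by rewrite invr_gt0; lra.
have bi : 1 <= b^-1 by rewrite invf_ge1.
have -> : `|(1 - b^-1) * a^-1| = (b^-1 - 1) * a^-1.
  by rewrite normrM (gtr0_norm ai) ler0_norm ?opprB//; lra.
split.
- rewrite divr_ge0 ?mulr_ge0//=; [|lra|lra|lra].
  by rewrite ler_pdivrMr// mul1r; lra.
- apply: (@le_trans _ _ ((b^-1 - 1) * a^-1 * ((a - 1) * b))).
    by rewrite ler_wpM2l// mulr_ge0; lra.
  have -> : (b^-1 - 1) / a * ((a - 1) * b) = (1 - b) * (1 - a^-1).
    by field; rewrite !gt_eqF//; lra.
  by nra.
- have -> : (b^-1 - 1) / a * (a * b / (1 + (a - 1) * b)) = (1 - b) / (1 + (a - 1) * b).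
    by field; rewrite !gt_eqF//; lra.
  by rewrite ler_pdivrMr// mul1r; nra.
Qed.

Lemma halfline_bound_backward t x M : t <= 0 -> 0 < x ->
  (forall y : R, 0 < y -> `|u 0 y| <= M) -> `|u t x| <= 2 * M.
Proof.
move=> t0 x0 uM; rewrite halfline_formula// (le_trans (ler_normD _ _))//.
have X0 := foot_gt0 t x x0.
have [_ kX _] := backward_weight t x t0 x0.
have M0 : 0 <= M by rewrite (le_trans _ (uM _ X0)).
have VX := antiderivative_le _ _ M (hs_V hs 0) (hs_V0 hs 0) uM _ X0.
rewrite mulr_natl mulr2n lerD ?uM// normrM.
apply: le_trans (ler_wpM2l (normr_ge0 _) VX) _.
by rewrite mulrCA -[leRHS]mulr1 ler_wpM2l.
Qed.

Lemma halfline_derivative_bound_backward t x M M' : t <= 0 -> 0 < x ->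
  (forall y : R, 0 < y -> `|u 0 y| <= M) ->
  (forall y : R, 0 < y -> `|ux 0 y| <= M') -> `|ux t x| <= M' + 2 * M.
Proof.
move=> t0 x0 uM uxM; rewrite halfline_derivative//.
have X0 := foot_gt0 t x x0.
have [/andP[s0 s1] kX ks] := backward_weight t x t0 x0.
have M0 : 0 <= M by rewrite (le_trans _ (uM _ X0)).
have VX := antiderivative_le _ _ M (hs_V hs 0) (hs_V0 hs 0) uM _ X0.
rewrite (le_trans (ler_normD _ _))// lerD//.
  by rewrite normrM (ger0_norm s0) (le_trans _ (uxM _ X0))// ler_piMr.
(* both terms of the bracket are at most [M] after the weight is applied *)
rewrite normrM.
apply: (@le_trans _ _ (`|(1 - expR (- t)) * expR (- x)| * (M * foot_slope t x + M * foot t x))).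
  rewrite ler_wpM2l// (le_trans (ler_normB _ _))// lerD// normrM (ger0_norm s0).
  by rewrite ler_wpM2r// uM.
rewrite mulrDr !(mulrCA _ M) -mulrDr mulrC ler_wpM2r//.
by lra.
Qed.

(** Near 0 the nonlocal term disappears, because [u 0] and [V 0] vanish there,
    while the foot is stretched by the factor [foot_slope t 0 = expR t]. *)
Lemma halfline_slope_at0 t (alpha : R) : u 0 0 = 0 -> ux 0 x @[x --> 0^'+] --> alpha ->
  ux t x @[x --> 0^'+] --> alpha * expR t.
Proof.
move=> u00 ux0.
have foot0 : foot t 0 = 0 by rewrite /foot expR0 subrr mul0r addr0 ln1.
have cfoot : foot t x @[x --> 0^'+] --> 0.
  rewrite -[X in _ --> X]foot0; apply: cvg_at_right_filter.
  exact: (is_derive1_continuous (derive_foot t 0 (lexx _))).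
have cfoot_right : foot t x @[x --> 0^'+] --> 0^'+.
  move=> P /= nP.
  have : \forall x \near 0^'+, 0 < foot t x -> P (foot t x) := cfoot _ nP.
  have : \forall x \near 0^'+, (0 : R) < x by exact: nbhs_right_gt.
  by apply: filterS2 => x x0; apply; exact: foot_gt0.
have cux : ux 0 (foot t x) @[x --> 0^'+] --> alpha by exact: (cvg_comp _ _ cfoot_right ux0).
have cu : u 0 (foot t x) @[x --> 0^'+] --> 0.
  by rewrite -[X in _ --> X]u00; apply: (cvg_comp _ _ cfoot); exact: (hs_cont_u hs).
have cV : V 0 (foot t x) @[x --> 0^'+] --> 0.
  rewrite -[X in _ --> X](hs_V0 hs 0); apply: (cvg_comp _ _ cfoot).
  exact: (is_derive1_continuous (hs_V hs 0 0)).
have cexp : expR x @[x --> 0^'+] --> (1 : R).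
  by rewrite -expR0; apply: cvg_at_right_filter; exact: continuous_expR.
have cexpN : expR (- x) @[x --> 0^'+] --> (1 : R).
  rewrite -[X in _ --> X]expR0 -[X in expR X]oppr0; apply: cvg_at_right_filter.
  exact: (is_derive1_continuous (is_derive1_expRN 0)).
have cs : foot_slope t x @[x --> 0^'+] --> expR t.
  have -> : expR t = 1 * expR t / (1 + (1 - 1) * expR t).
    by rewrite subrr mul0r addr0 divr1 mul1r.
  apply: cvgM; first by apply: cvgM => //; exact: cvg_cst.
  apply: cvgV; first by rewrite subrr mul0r addr0 oner_neq0.
  apply: cvgD; first exact: cvg_cst.
  by apply: cvgM; [apply: cvgB => //; exact: cvg_cst|exact: cvg_cst].
have -> : alpha * expR t = alpha * expR t + (1 - expR (- t)) * 1 * (0 * expR t - 0) by ring.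
have H : (ux 0 (foot t x) * foot_slope t x + (1 - expR (- t)) * expR (- x) *
    (u 0 (foot t x) * foot_slope t x - V 0 (foot t x))) @[x --> 0^'+] -->
    alpha * expR t + (1 - expR (- t)) * 1 * (0 * expR t - 0).
  apply: cvgD; first exact: cvgM.
  apply: cvgM; first by apply: cvgM => //; exact: cvg_cst.
  by apply: cvgB => //; exact: cvgM.
apply: cvg_trans H; apply: near_eq_cvg; near=> x.
by rewrite -halfline_derivative.
Unshelve. all: by end_near. Qed.

Lemma halfline_slope_ge t (alpha M : R) : u 0 0 = 0 -> ux 0 x @[x --> 0^'+] --> alpha ->
  (forall x : R, 0 < x -> `|ux t x| <= M) -> alpha * expR t <= M.
Proof.
move=> u00 /(halfline_slope_at0 t _ u00) cv uxM.
rewrite -(cvg_lim _ cv)//; apply: limr_le; first exact: (cvgP _ cv).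
near=> x; apply: le_trans (ler_norm _) _; apply: uxM.
by near: x; exact: nbhs_right_gt.
Unshelve. all: by end_near. Qed.

End halfline.

(** * Norms and the nonlocal term *)

Section norms.
Context {R : realType}.
Implicit Types (u : R -> R) (D : set R) (x y : R).

Let mu := @lebesgue_measure R.

Lemma lebesgue_setT_gt0 : (0 < mu [set: R])%E.
Proof.
apply: (@lt_le_trans _ _ (mu (ball (0 : R) 1))).
  by rewrite /mu lebesgue_measure_ball ?ler01// lte_fin.
by apply: le_measure; rewrite ?inE//; exact: measurable_ball.
Qed.

Lemma Lnorm_on_yE D u : Lnorm_on +oo D u = ess_sup mu (fun x => `|(u \_ D) x|%:E).
Proof. by rewrite /Lnorm_on unlock lebesgue_setT_gt0. Qed.

Lemma Lnorm_on_y_le D u (M : \bar R) : (0 <= M)%E ->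
  (forall x, D x -> (`|u x|%:E <= M)%E) -> (Lnorm_on +oo D u <= M)%E.
Proof.
move=> M0 uM; rewrite Lnorm_on_yE; apply/ess_supP/nearW => x.
by rewrite patchE; case: ifPn => [/set_mem/uM//|_]; rewrite normr0.
Qed.

(** The essential supremum sees every point of continuity: a larger value at
    one of them would be attained on a ball, which has positive measure. *)
Lemma Lnorm_on_y_ge D u x : open D -> D x -> {for x, continuous u} ->
  (`|u x|%:E <= Lnorm_on +oo D u)%E.
Proof.
move=> oD Dx cu; rewrite leNgt; apply/negP => Lu.
have L0 : (0 <= Lnorm_on +oo D u)%E by exact: Lnorm_ge0.
have [l l0 El] : exists2 l : R, 0 <= l & Lnorm_on +oo D u = l%:E.
  move: L0 Lu; case: (Lnorm_on +oo D u) => [l| |] //= l0 _.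
  by exists l; rewrite -?lee_fin.
rewrite El lte_fin in Lu.
have : \forall y \near x, D y /\ l < `|u y|.
  near=> y; split; first by near: y; exact: open_nbhs_nbhs.
  near: y; have cn : `|u y| @[y --> x] --> `|u x| by exact: cvg_norm.
  exact: (cn _ (lt_nbhsr Lu)).
move=> /nbhs_ballP[r/= r0 Br].
have : (ess_sup mu (fun x => `|(u \_ D) x|%:E) <= l%:E)%E by rewrite -Lnorm_on_yE El.
move=> /ess_supP[N [mN N0 subN]].
have ball_gt0 : (0 < mu (ball x r))%E.
  by rewrite /mu lebesgue_measure_ball ?ltW// lte_fin pmulrn_lgt0.
have ball_le : (mu (ball x r) <= mu N)%E.
  apply: le_measure; rewrite ?inE//; first exact: measurable_ball.
  move=> y /Br[Dy ly]; apply: subN => /=.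
  by rewrite patchE mem_set// lee_fin leNgt ly.
by have := lt_le_trans ball_gt0 ball_le; rewrite [X in (_ < X)%E -> _]N0 ltxx.
Unshelve. all: by end_near. Qed.

Lemma continuous_integrable_itv u (a b : R) : continuous u ->
  mu.-integrable `[a, b] (EFin \o u).
Proof.
move=> cu; apply: continuous_compact_integrable; first exact: segment_compact.
exact: continuous_subspaceT.
Qed.

(** Both branches of [int0] are increments of the integral from a common base
    point [a] left of [x] and of 0, so one fundamental theorem covers all signs. *)
Lemma derive_int0 u x : continuous u -> is_derive x 1 (int0 u) (u x).
Proof.
move=> cu.
pose a := - `|x| - 1.
have ax : a < x by rewrite /a; have := ler_norm (- x); rewrite normrN; lra.
have a0 : a < 0 by rewrite /a; have := normr_ge0 x; lra.
pose F y := \int[mu]_(t in `[a, y]) u t.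
have dF : is_derive x 1 F (u x).
  have xx1 : x < x + 1 by lra.
  have [dF F'] := continuous_FTC1_closed xx1 (continuous_integrable_itv u a (x + 1) cu) ax (cu x).
  by split; [exact: dF|rewrite -derive1E; exact: F'].
suff : \forall y \near x, F y - F 0 = int0 u y.
  move=> FE; apply: (near_eq_is_derive FE).
  by apply: (is_derive_eq (is_derive1B dF (is_derive_cst (F 0) x (1 : R)))); rewrite subr0.
near=> y.
have ay : a < y by near: y; exact: lt_nbhsr.
rewrite /int0 /F; case: ifPn => [y0|]; last rewrite -ltNge => y0.
  rewrite (Rintegral_itvB (continuous_integrable_itv u _ _ cu)) ?bnd_simp ?(ltW a0)//.
  rewrite Rintegral_itv_obnd_cbnd//.
  apply: integrableS (continuous_integrable_itv u 0 y cu) => //.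
  exact: subset_itv_oc_cc.
rewrite -opprB (Rintegral_itvB (continuous_integrable_itv u _ _ cu)) ?bnd_simp ?(ltW ay) ?(ltW y0)//.
rewrite Rintegral_itv_obnd_cbnd//.
apply: integrableS (continuous_integrable_itv u y 0 cu) => //.
exact: subset_itv_oc_cc.
Unshelve. all: by end_near. Qed.

Lemma int0_0 u : int0 u 0 = 0.
Proof. by rewrite /int0 lexx set_itv1 Rintegral_set1. Qed.

Lemma int0_le_Lnorm1 u x : continuous u -> 0 < x ->
  (`|int0 u x|%:E <= Lnorm_on 1 (@Rpos R) u)%E.
Proof.
move=> cu x0; rewrite /int0 (ltW x0).
have iu := continuous_integrable_itv u 0 x cu.
have mu_u : measurable_fun setT u by exact: continuous_measurable_fun.
rewrite /Rintegral -[leLHS]/`|(fine _)%:E|%E fineK; last exact: integrable_fin_num.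
apply: le_trans (le_abse_integral _ _ _) _ => //; first exact: (measurable_int _ iu).
rewrite -integral_itv_obnd_cbnd; last first.
  by apply: measurableT_comp => //; apply/measurable_EFinP; exact: measurable_funS mu_u.
rewrite /Lnorm_on Lnorm1.
rewrite [leRHS](_ : _ = \int[mu]_(y in @Rpos R) `|(u y)%:E|)%E; last first.
  rewrite [RHS]integral_mkcond; apply: eq_integral => y _.
  by rewrite /= !patchE; case: ifPn => //; rewrite normr0.
apply: ge0_subset_integral => //.
- exact: measurable_itv.
- apply: measurableT_comp => //; apply/measurable_EFinP; exact: measurable_funS mu_u.
- by move=> y; rewrite /Rpos/= !in_itv/= => /andP[->].
Qed.

End norms.

(** * The Cauchy problem on the two half-lines *)

Section cauchy.
Context {R : realType} {v0 : R -> R} {v : R -> R -> R}.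
Hypothesis hv : solves_Cauchy v0 v.
Implicit Types t x : R.

Let C10v t : C10 (v t). Proof. by have [[H _] _ _] := hv; have [] := H t. Qed.

Let cont_v t : continuous (v t). Proof. by have [] := C10v t. Qed.

Let derivable_v t x : x != 0 -> derivable (v t) x 1.
Proof. by have [_ H _ _ _] := C10v t; move=> /H[]. Qed.

Let cont_vx t x : x != 0 -> {for x, continuous (v t)^`()%classic}.
Proof. by have [_ H _ _ _] := C10v t; move=> /H[]. Qed.

Let is_derive_v t x : x != 0 -> is_derive x 1 (v t) ((v t)^`()%classic x).
Proof. by move=> x0; rewrite derive1E; apply/derivableP/derivable_v. Qed.

(** Off 0 both [v t \- v t0] and its derivative are continuous, so that their
    essential suprema, which the C^1_0 norm makes small, bound them pointwise. *)
Lemma cauchy_unif t0 (e : R) : 0 < e -> \forall t \near t0, forall x : R, x != 0 ->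
  `|v t x - v t0 x| <= e /\ `|(v t)^`()%classic x - (v t0)^`()%classic x| <= e.
Proof.
move=> e0; have [[_ cv] _ _] := hv.
have {}cv := cv t0.
have : \forall t \near t0, ((H1_norm (v t \- v t0)%R + C10_norm (v t \- v t0)%R) < e%:E)%E.
  apply: (cv [set y | (y < e%:E)%E]); apply: open_nbhs_nbhs; split => /=.
    exact: open_ereal_lt_ereal.
  by rewrite lte_fin.
apply: filterS => t te x x0.
have H0 : (0 <= H1_norm (v t \- v t0)%R)%E by exact: poweR_ge0.
have L1 : (0 <= Lnorm_on +oo setT (v t \- v t0)%R)%E by exact: Lnorm_ge0.
have L2 : (0 <= Lnorm_on +oo setT (v t \- v t0)%R^`()%classic)%E by exact: Lnorm_ge0.
have Ce : (C10_norm (v t \- v t0)%R <= e%:E)%E.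
  by apply: le_trans (ltW te); rewrite leeDr.
have near_x : \forall y \near x, y != 0.
  by apply: (open_nbhs_nbhs (A := [set y : R | y != 0])); split => //; exact: open_neq.
have diffE y : y != 0 -> (v t \- v t0)^`()%classic y = (v t)^`()%classic y - (v t0)^`()%classic y.
  by move=> y0; rewrite !derive1E deriveB//; exact: derivable_v.
split; rewrite -lee_fin.
- apply: le_trans (le_trans (leeDl _ L2) Ce).
  apply: (@Lnorm_on_y_ge _ setT (v t \- v t0)) => //; first exact: openT.
  by apply: continuousB; exact: cont_v.
- apply: le_trans (le_trans (leeDr _ L1) Ce).
  rewrite -diffE//; apply: Lnorm_on_y_ge => //; first exact: openT.
  rewrite /prop_for /continuous_at diffE//.
  have c : (v t)^`()%classic y - (v t0)^`()%classic y @[y --> x] --> (v t)^`()%classic x - (v t0)^`()%classic x.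
    by apply: cvgB; exact: cont_vx.
  apply: cvg_trans c; apply: near_eq_cvg.
  by apply: filterS near_x => y y0; rewrite diffE.
Qed.

Lemma cauchy_halfline_pos :
  halfline_solution v (fun t => (v t)^`()%classic) (fun t => int0 (v t)).
Proof.
split.
- by move=> t x x0; apply: is_derive_v; rewrite gt_eqF.
- by move=> t x x0; apply: cont_vx; rewrite gt_eqF.
- by move=> t x; exact: derive_int0.
- by move=> t; exact: int0_0.
- exact: cont_v.
- move=> t0 e e0; apply: filterS (cauchy_unif t0 e e0) => t H x x0.
  by apply: H; rewrite gt_eqF.
- move=> t x x0; have [_ _ H] := hv.
  by have := H t x; rewrite /peakon gtr0_norm//; apply; rewrite gt_eqF.
Qed.

(** Reflecting space and time preserves the equation: [v_x] and the integral
    from 0 both change sign, and so does the time derivative. *)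
Lemma cauchy_halfline_neg :
  halfline_solution (fun t x => v (- t) (- x)) (fun t x => - (v (- t))^`()%classic (- x))
    (fun t x => - int0 (v (- t)) (- x)).
Proof.
have dN (f : R -> R) (x l : R) : is_derive (- x) 1 f l ->
    is_derive x 1 (fun y : R => f (- y)) (- l).
  move=> df; rewrite -mulrN1.
  exact: (@is_derive1C _ f -%R x _ _ df (is_deriveNid x (1 : R))).
have cN (f : R -> R) (x : R) : {for - x, continuous f} ->
    {for x, continuous (fun y : R => f (- y))}.
  by move=> cf; apply: continuous_comp => //; exact: opp_continuous.
split.
- by move=> t x x0; apply: dN; apply: is_derive_v; rewrite oppr_eq0 gt_eqF.
- move=> t x x0; apply: continuousN; apply: (cN (v (- t))^`()%classic).
  by apply: cont_vx; rewrite oppr_eq0 gt_eqF.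
- move=> t x; rewrite -[v _ _]opprK; apply: is_derive1N; apply: dN.
  exact: derive_int0.
- by move=> t; rewrite oppr0 int0_0 oppr0.
- by move=> t x; apply: cN; exact: cont_v.
- move=> t0 e e0.
  have : \forall t \near t0, forall x : R, x != 0 ->
    `|v (- t) x - v (- t0) x| <= e /\ `|(v (- t))^`()%classic x - (v (- t0))^`()%classic x| <= e.
    exact: (opp_continuous t0 _ (cauchy_unif (- t0) e e0)).
  apply: filterS => t Ht x x0.
  have [|? ?] := Ht (- x); first by rewrite oppr_eq0 gt_eqF.
  by split => //; rewrite -opprD normrN.
- move=> t x x0; have [_ _ H] := hv.
  have Nx0 : - x != 0 by rewrite oppr_eq0 gt_eqF.
  have := dN (fun s => v s (- x)) t _ (H (- t) (- x) Nx0).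
  rewrite /peakon normrN gtr0_norm// => dv.
  by apply: (is_derive_eq dv); ring.
Qed.

End cauchy.

(** * The estimates *)

Theorem lemma4 (R : realType) (v0 : R -> R) (alpha : R) (v : R -> R -> R)
  (hv0H1 : H1 v0) (hv0C10 : C10 v0) (hv0L1 : v0 \in Lfun lebesgue_measure 1%E)
  (hv00 : v0 0 = 0)
  (halpha : v0^`() x @[x --> 0^'+] --> alpha) (halpha0 : alpha != 0)
  (hv : solves_Cauchy v0 v) (hvt0 : forall t : R, v t 0 = 0) :
  forall t : R, 0 <= t ->
  [/\ (Lnorm_on +oo (@Rpos R) (v t)
         <= Lnorm_on +oo (@Rpos R) v0 + Lnorm_on 1 (@Rpos R) v0)%E,
      (Lnorm_on +oo (@Rneg R) (v t) <= 2%:E * Lnorm_on +oo (@Rneg R) v0)%E,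
      ((alpha * expR t)%:E <= Lnorm_on +oo (@Rpos R) (v t)^`())%E &
      (Lnorm_on +oo (@Rneg R) (v t)^`()
         <= Lnorm_on +oo (@Rneg R) v0^`()
            + 2%:E * Lnorm_on +oo (@Rneg R) v0)%E].
Proof.
move=> t t0.
have hp := cauchy_halfline_pos hv; have hn := cauchy_halfline_neg hv.
have [[C10v _] v0E _] := hv.
have [cont_v0 reg_v0 _ _ _] := hv0C10.
have [_ reg_vt _ _ _] := (C10v t).2.
have RposE (x : R) : @Rpos R x <-> 0 < x by rewrite /Rpos/= in_itv/= andbT.
have RnegE (x : R) : @Rneg R x <-> x < 0 by rewrite /Rneg/= in_itv.
have openRpos : open (@Rpos R) by exact: interval_open.
have openRneg : open (@Rneg R) by exact: interval_open.
have norm_ge0 p D (u : R -> R) : (0 <= Lnorm_on p D u)%E by exact: Lnorm_ge0.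
have neg_ge (u : R -> R) (x : R) (M : R) : Lnorm_on +oo (@Rneg R) u = M%:E ->
    {for - x, continuous u} -> 0 < x -> `|u (- x)| <= M.
  move=> uM cu x0; rewrite -lee_fin -uM; apply: Lnorm_on_y_ge => //.
  by apply/RnegE; rewrite oppr_lt0.
have norm_neg (u : R -> R) : Lnorm_on +oo (@Rneg R) u = +oo%E \/
    exists2 M : R, Lnorm_on +oo (@Rneg R) u = M%:E & 0 <= M.
  have := norm_ge0 +oo%E (@Rneg R) u.
  case: (Lnorm_on +oo (@Rneg R) u) => [M| |]// M0; last by left.
  by right; exists M.
split.
- apply: Lnorm_on_y_le; first by rewrite adde_ge0.
  move=> x /RposE x0; have X0 := foot_gt0 t x x0.
  have := halfline_bound_forward hp t x t0 x0; rewrite v0E -lee_fin EFinD => /le_trans; apply.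
  apply: leeD; last exact: int0_le_Lnorm1.
  by apply: Lnorm_on_y_ge => //; [exact/RposE|exact: cont_v0].
- have [->|[M NM M0]] := norm_neg v0.
    by rewrite mulry gtr0_sg// mul1e leey.
  rewrite NM -EFinM; apply: Lnorm_on_y_le; first by rewrite lee_fin mulr_ge0.
  move=> x /RnegE x0; rewrite lee_fin.
  have := halfline_bound_backward hn (- t) (- x) M.
  rewrite !opprK oppr_le0 oppr_gt0; apply => // y y0.
  by rewrite oppr0 v0E; apply: neg_ge => //; exact: cont_v0.
(* the supremum of |v_x| dominates its limit at 0+ *)
- have := norm_ge0 +oo%E (@Rpos R) (v t)^`()%classic.
  case E : (Lnorm_on +oo (@Rpos R) (v t)^`()%classic) => [M| |]// M0; last by rewrite leey.
  rewrite lee_fin; apply: (halfline_slope_ge hp t alpha M); rewrite ?v0E// => x x0.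
  rewrite -lee_fin -E; apply: Lnorm_on_y_ge => //; first exact/RposE.
  by have [] := reg_vt x (lt0r_neq0 x0).
- have [->|[M NM M0]] := norm_neg v0.
    by rewrite mulry gtr0_sg// mul1e addey ?leey// gt_eqF// (lt_le_trans _ (norm_ge0 _ _ _)).
  have [->|[M' NM' M'0]] := norm_neg v0^`()%classic.
    by rewrite addye ?leey// NM -EFinM.
  rewrite NM NM' -EFinM -EFinD; apply: Lnorm_on_y_le.
    by rewrite lee_fin addr_ge0// mulr_ge0.
  move=> x /RnegE x0; rewrite lee_fin.
  have := halfline_derivative_bound_backward hn (- t) (- x) M M'.
  rewrite !opprK oppr_le0 oppr_gt0 normrN; apply => // y y0; rewrite oppr0 v0E ?normrN.
    by apply: neg_ge => //; exact: cont_v0.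
  apply: neg_ge => //; have Ny0 : - y != 0 by rewrite oppr_eq0 gt_eqF.
  by have [] := reg_v0 (- y) Ny0.
Qed.
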